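(* Let $\mathbb A$ be an algebra on $\mathbb R^n$, let $k\in\{2,\dots,n\}$, let $U\subset\mathbb R^k$ be an open set, and let $f,\varphi:U\to\mathbb R^n$ be differentiable in the usual sense. If $f$ is $\varphi\mathbb A$-differentiable, then $d\varphi(e_j)\,f_{u_i}=d\varphi(e_i)\,f_{u_j}$ on $U$ for all $i,j\in\{1,\dots,k\}$; that is, the components of $f$ satisfy the $\varphi\mathbb A$-Cauchy-Riemann equations.
   Context: An algebra $\mathbb A$ on $\mathbb R^n$ is the real linear space $\mathbb R^n$ with a bilinear, associative, commutative product having a unit $e$. For $f,\varphi:U\subset\mathbb R^k\to\mathbb R^n$ differentiable in the usual sense, $f$ is $\varphi\mathbb A$-differentiable on $U$ if there is a function $f'_\varphi:U\to\mathbb R^n$ such that $df_u(\xi)=f'_\varphi(u)\,d\varphi_u(\xi)$ ($\mathbb A$-product) for all $u\in U$, $\xi\in\mathbb R^k$. Here $f_{u_i}$ is the partial derivative of $f$ with respect to the $i$-th coordinate $u_i$ of $\mathbb R^k$, $d\varphi(e_i)$ is the usual differential of $\varphi$ applied to the $i$-th canonical vector of $\mathbb R^k$, and products are $\mathbb A$-products. *)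

(* Defs.v *)
From HB Require Import structures.
From mathcomp Require Import all_boot all_order all_algebra.
From mathcomp Require Import all_classical all_reals all_analysis.

Set Implicit Arguments.
Unset Strict Implicit.
Unset Printing Implicit Defensive.
Import Order.TTheory GRing.Theory Num.Theory.
Import numFieldNormedType.Exports.

Local Open Scope classical_set_scope.
Local Open Scope ring_scope.

(* R^n is 'rV[R]_n with its usual real vector space structure and the sup
   norm (all norms on R^n give the same notion of differentiability). *)
Record algebra (R : realType) (n : nat) : Type := Algebra {
  amul : {bilinear 'rV[R]_n -> 'rV[R]_n -> 'rV[R]_n};
  aunit : 'rV[R]_n;
  amulA : associative amul;
  amulC : commutative amul;
  amul1x : left_id aunit amul
}.

Definition canonical_vec (R : realType) (k : nat) (i : 'I_k) : 'rV[R]_k :=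
  delta_mx 0 i.

Definition partial_deriv (R : realType) (k n : nat)
    (f : 'rV[R]_k -> 'rV[R]_n) (i : 'I_k) (u : 'rV[R]_k) : 'rV[R]_n :=
  'D_(canonical_vec R i) f u.

(* A function on an open set U is represented by a total function of which
   only the germs at the points of U are used.  The two definitions below are
   meant for f and phi differentiable at every point of U: otherwise
   the library's 'd and 'D are only default values. *)
Definition phiA_differentiable (R : realType) (k n : nat) (A : algebra R n)
    (phi : 'rV[R]_k -> 'rV[R]_n) (U : set 'rV[R]_k)
    (f : 'rV[R]_k -> 'rV[R]_n) : Prop :=
  exists f'phi : 'rV[R]_k -> 'rV[R]_n,
    forall u : 'rV[R]_k, U u ->
    forall xi : 'rV[R]_k, 'd f u xi = amul A (f'phi u) ('d phi u xi).

Definition phiA_Cauchy_Riemann (R : realType) (k n : nat) (A : algebra R n)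
    (phi : 'rV[R]_k -> 'rV[R]_n) (U : set 'rV[R]_k)
    (f : 'rV[R]_k -> 'rV[R]_n) : Prop :=
  forall (i j : 'I_k) (u : 'rV[R]_k), U u ->
    amul A ('d phi u (canonical_vec R j)) (partial_deriv f i u) =
    amul A ('d phi u (canonical_vec R i)) (partial_deriv f j u).

(* Main.v *)
Require Import Defs.
From HB Require Import structures.
From mathcomp Require Import all_boot all_order all_algebra.
From mathcomp Require Import all_classical all_reals all_analysis.

Import numFieldNormedType.Exports.

Local Open Scope classical_set_scope.
Local Open Scope ring_scope.

(** Evaluating the defining identity at the canonical vectors writes each partial derivative of [f]
    as one common factor times a directional differential of [phi]. Both sides then become the same
    triple product in a commutative, associative algebra. *)

Theorem proposition1p5 (R : realType) (n : nat) (A : algebra R n)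
    (k : nat) (hk : (2 <= k <= n)%N)
    (U : set 'rV[R]_k) (hU : open U)
    (f phi : 'rV[R]_k -> 'rV[R]_n)
    (hf : forall u : 'rV[R]_k, U u -> differentiable f u)
    (hphi : forall u : 'rV[R]_k, U u -> differentiable phi u)
    (hfphi : phiA_differentiable A phi U f) :
  phiA_Cauchy_Riemann A phi U f.
Proof.
case: hfphi => g dfE i j u Uu.
(* Differentiability of [f] at [u] enters here, through [deriveE]: it identifies ['D] with ['d]
   applied to the vector. *)
have Di l : partial_deriv f l u = amul A (g u) ('d phi u (canonical_vec R l)).
  by apply: etrans (dfE u Uu _); exact: (deriveE (canonical_vec R l) (hf u Uu)).
rewrite (Di i) (Di j).
set a := 'd phi u (canonical_vec R i).
set b := 'd phi u (canonical_vec R j).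
(* Moving [g u] to the right reduces the goal [b (g u a) = a (g u b)] to [b a = a b]. *)
rewrite (amulC A _ a) (amulC A _ b) (amulA A b) (amulA A a).
by rewrite (amulC A b a).
Qed.
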